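(* For any positive integer $n$, and any constants $R>1$ and $\epsilon>0$, there is a constant $L>0$ such that the following holds. For any degree $n$ polynomial $p\in\mathbb{C}[z]$ having all of its zeros in the unit disk, and any rational function $h$, if $\rho_h(0)<L$ and $h(0)$ is finite and non-zero, then: 1. If $z$ is a critical point of $p$ with multiplicity $m$, then there are at least $m$ critical points of $p\cdot h$, counted with multiplicity, lying within $\epsilon$ of $z$. 2. There are exactly $n-1$ critical points of $p\cdot h$, counted with multiplicity, lying in the disk centered at the origin with radius $R$.
   Context: Rational functions are elements of $\mathbb{C}(z)$, not identically zero. For a rational function $h$, let $Z_h$ and $P_h$ denote the sets of distinct finite zeros and distinct finite poles of $h$, respectively. For $w\in Z_h\cup P_h$, $\mathrm{mult}_h(w)$ denotes the multiplicity of $w$ as a zero or pole of $h$, taken positive if $w$ is a zero and negative if $w$ is a pole. For $z\in\mathbb{C}$, $$\rho_h(z)=\sum_{w\in Z_h\cup P_h,\ w\neq z}\left|\dfrac{\mathrm{mult}_h(w)}{z-w}\right|.$$ A critical point of a non-constant rational function $f$ is a point of $\mathbb{C}$ that is a zero of $f'$; its multiplicity is its order as a zero of $f'$. ''Within $\epsilon$ of $z$'' means at distance less than $\epsilon$ from $z$. The unit disk is $\{z\in\mathbb{C}:|z|<1\}$ and the disk of radius $R$ centered at the origin is $\{z\in\mathbb{C}:|z|<R\}$. *)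

(* Defs.v *)
From mathcomp Require Export all_boot all_order all_algebra.
From mathcomp Require Export reals complex.
From mathcomp Require Import ring.

Set Implicit Arguments.
Unset Strict Implicit.
Unset Printing Implicit Defensive.

Import Order.TTheory GRing.Theory Num.Theory.

Local Open Scope ring_scope.
Local Open Scope quotient_scope.

Notation "x %:F" := (@FracField.tofrac _ x) : ring_scope.

(* Numerator and denominator in lowest terms; see [ratE] and [coprime_rat]. *)
Definition rnum (F : fieldType) (h : {fraction {poly F}}) : {poly F} :=
  \n_(repr h) %/ gcdp \n_(repr h) \d_(repr h).
Definition rden (F : fieldType) (h : {fraction {poly F}}) : {poly F} :=
  \d_(repr h) %/ gcdp \n_(repr h) \d_(repr h).

(* All roots of [p], repeated according to multiplicity; junk if [p] = 0. *)
Definition root_seq (F : closedFieldType) (p : {poly F}) : seq F :=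
  sval (closed_field_poly_normal p).

Definition zeros (F : closedFieldType) (h : {fraction {poly F}}) : seq F :=
  undup (root_seq (rnum h)).
Definition poles (F : closedFieldType) (h : {fraction {poly F}}) : seq F :=
  undup (root_seq (rden h)).

Definition mult (F : closedFieldType) (h : {fraction {poly F}}) (w : F) : int :=
  (mup w (rnum h))%:Z - (mup w (rden h))%:Z.

Definition finite_at (F : closedFieldType) (h : {fraction {poly F}}) (z : F) :
  bool := z \notin poles h.
(* Only meaningful when [finite_at h z]. *)
Definition reval (F : closedFieldType) (h : {fraction {poly F}}) (z : F) : F :=
  (rnum h).[z] / (rden h).[z].

Definition rho (F : numClosedFieldType) (h : {fraction {poly F}}) (z : F) : F :=
  \sum_(w <- undup (zeros h ++ poles h) | w != z)
     `| (mult h w)%:~R / (z - w) |.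

Definition nonconstant (F : fieldType) (h : {fraction {poly F}}) : Prop :=
  forall c : F, h <> (c%:P)%:F.

(* By [rderiv_frac] the quotient rule may be applied to any representative. *)
Definition rderiv (F : fieldType) (h : {fraction {poly F}}) :
  {fraction {poly F}} :=
  ((rnum h)^`() * rden h - rnum h * (rden h)^`())%:F / (rden h ^+ 2)%:F.

(* Critical points are the zeros of the derivative.  The next three definitions
   are only meaningful when [f] is nonconstant. *)
Definition crit_points (F : closedFieldType) (f : {fraction {poly F}}) :
  seq F := zeros (rderiv f).
Definition crit_mult (F : closedFieldType) (f : {fraction {poly F}}) (z : F) :
  nat := mup z (rnum (rderiv f)).
Definition num_crit (F : closedFieldType) (f : {fraction {poly F}})
  (D : pred F) : nat :=
  (\sum_(w <- crit_points f | D w) crit_mult f w)%N.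

Lemma repr_fracE (F : fieldType) (h : {fraction {poly F}}) :
  h = (\n_(repr h))%:F / (\d_(repr h))%:F.
Proof.
have d0 : \d_(repr h) != 0 by exact: denom_ratioP.
rewrite -[LHS]reprK -[in LHS](Ratio_numden (repr h)); unlock FracField.tofrac.
rewrite -[X in _ = _ * X]FracField.pi_inv -[RHS]FracField.pi_mul.
by rewrite /FracField.mulf /FracField.invf
  !numden_Ratio ?(oner_neq0, mul1r, mulr1).
Qed.

Lemma gcd_numden_neq0 (F : fieldType) (h : {fraction {poly F}}) :
  gcdp \n_(repr h) \d_(repr h) != 0.
Proof. by rewrite gcdp_eq0 negb_and denom_ratioP orbT. Qed.

Lemma rden_neq0 (F : fieldType) (h : {fraction {poly F}}) : rden h != 0.
Proof.
by rewrite /rden dvdp_div_eq0 ?dvdp_gcdr // denom_ratioP.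
Qed.

Lemma ratE (F : fieldType) (h : {fraction {poly F}}) :
  h = (rnum h)%:F / (rden h)%:F.
Proof.
have g0 := gcd_numden_neq0 h; rewrite {1}(repr_fracE h) /rnum /rden.
set n := \n_(repr h) in g0 *; set d := \d_(repr h) in g0 *.
set g := gcdp n d in g0 *.
have en : n = n %/ g * g by rewrite divpK ?dvdp_gcdl.
have ed : d = d %/ g * g by rewrite divpK ?dvdp_gcdr.
by rewrite {1}en {1}ed !tofracM -mulf_div divff ?mulr1 // tofrac_eq0.
Qed.

Lemma coprime_rat (F : fieldType) (h : {fraction {poly F}}) :
  coprimep (rnum h) (rden h).
Proof. by rewrite coprimep_div_gcd // denom_ratioP orbT. Qed.

Lemma rderiv_frac (F : fieldType) (a b : {poly F}) : b != 0 ->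
  rderiv (a%:F / b%:F) = (a^`() * b - a * b^`())%:F / (b ^+ 2)%:F.
Proof.
move=> b0; set h := _ / _; rewrite /rderiv.
set n := rnum h; set d := rden h.
have d0 : d != 0 by exact: rden_neq0.
have e : n * b = a * d.
  apply/eqP; rewrite -tofrac_eq !tofracM -eqr_div ?tofrac_eq0 //.
  by rewrite -ratE.
have e' := congr1 (@deriv F) e; rewrite !derivM in e'.
apply/eqP; rewrite eqr_div ?tofrac_eq0 ?expf_neq0 // -!tofracM tofrac_eq.
rewrite -subr_eq0; apply/eqP.
transitivity (d * b * (n^`() * b + n * b^`() - (a^`() * d + a * d^`()))
              - (b * d^`() + d * b^`()) * (n * b - a * d)); first by ring.
by rewrite e' e !subrr !mulr0 subrr.
Qed.

Lemma mem_root_seq (F : closedFieldType) (p : {poly F}) (z : F) :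
  p != 0 -> (z \in root_seq p) = root p z.
Proof.
rewrite /root_seq; case: closed_field_poly_normal => s /= ps p0.
by rewrite [in RHS]ps rootZ ?lead_coef_eq0 // root_prod_XsubC.
Qed.

(* Main.v *)
(** Near the disk of radius [r] the critical points of [p * h] are the zeros of
    [p' + p * (h' / h)], and [h' / h] is uniformly small there because [rho h 0]
    is.  Zeros in a disk are counted by a discrete argument principle: the
    average of [z * q'(z) / q(z)] over the [N]-th roots of [rho ^+ N] is the sum
    of [1 / (1 - (a / rho) ^+ N)] over the roots [a] of [q], which tends to the
    number of roots of modulus less than [rho].  Hence two polynomials whose
    logarithmic derivatives are close enough on a circle have equally many zeros
    inside.  The circles used are the one of radius [r], which stays away from
    the critical points of [p] by Gauss-Lucas, and, around a critical point, one
    whose radius below [eps] is chosen by pigeonhole to stay at distance at least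
    [eps / (2 * n)] from all critical points; this makes [L] independent of [p]. *)
Require Import Defs.
From mathcomp Require Import ring lra.
Import Order.TTheory GRing.Theory Num.Theory.
Local Open Scope ring_scope.
Local Open Scope complex_scope.

Set Implicit Arguments.
Unset Strict Implicit.
Unset Printing Implicit Defensive.

Local Notation normc := Normc.normc.

(** * Logarithmic derivatives of split polynomials, root multiplicities and counts *)

Lemma deriv_prod_XsubC (F : fieldType) (s : seq F) (z : F) : z \notin s ->
  (\prod_(w <- s) ('X - w%:P))^`().[z] =
  (\prod_(w <- s) ('X - w%:P)).[z] * \sum_(w <- s) (z - w)^-1.
Proof.
elim: s => [|w s IH]; first by rewrite !big_nil derivC horner0 mulr0.
rewrite inE negb_or => /andP[zw zs]; rewrite !big_cons derivM derivXsubC.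
rewrite !hornerE IH //.
have : z - w != 0 by rewrite subr_eq0.
by move=> ?; field.
Qed.

(** With [f = q' / q] one has [q'' / q = f ^+ 2 + f'], and differentiating each [(z - w)^-1] in [f]
    gives the subtracted squares. *)
Lemma deriv2_prod_XsubC (F : fieldType) (s : seq F) (z : F) : z \notin s ->
  (\prod_(w <- s) ('X - w%:P))^`()^`().[z] =
  (\prod_(w <- s) ('X - w%:P)).[z] *
  ((\sum_(w <- s) (z - w)^-1) ^+ 2 - \sum_(w <- s) (z - w)^-1 ^+ 2).
Proof.
elim: s => [|w s IH]; first by rewrite !big_nil !derivC horner0 expr2 mul0r subrr mulr0.
rewrite inE negb_or => /andP[zw zs]; rewrite !big_cons derivM derivXsubC.
rewrite mul1r derivD derivM derivXsubC.
rewrite !(hornerD, hornerM, hornerX, hornerN, hornerC) IH // deriv_prod_XsubC //.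
have : z - w != 0 by rewrite subr_eq0.
by move=> ?; field.
Qed.

Lemma root_seq_prod (F : closedFieldType) (p : {poly F}) :
  p = lead_coef p *: \prod_(w <- root_seq p) ('X - w%:P).
Proof. by rewrite /root_seq; case: closed_field_poly_normal. Qed.

Lemma deriv_root_seq (F : closedFieldType) (p : {poly F}) (z : F) :
  ~~ root p z -> p^`().[z] = p.[z] * \sum_(w <- root_seq p) (z - w)^-1.
Proof.
have [->|p0 pz] := eqVneq p 0; first by rewrite root0.
rewrite [in LHS](root_seq_prod p) [X in X.[z] * _](root_seq_prod p).
by rewrite derivZ !hornerZ deriv_prod_XsubC ?mulrA // mem_root_seq.
Qed.

Lemma deriv2_root_seq (F : closedFieldType) (p : {poly F}) (z : F) :
  ~~ root p z -> p^`()^`().[z] = p.[z] *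
    ((\sum_(w <- root_seq p) (z - w)^-1) ^+ 2
     - \sum_(w <- root_seq p) (z - w)^-1 ^+ 2).
Proof.
have [->|p0 pz] := eqVneq p 0; first by rewrite root0.
rewrite [in LHS](root_seq_prod p) [X in X.[z] * _](root_seq_prod p).
by rewrite !derivZ !hornerZ deriv2_prod_XsubC ?mulrA // mem_root_seq.
Qed.

Lemma count_mem_root_seq (F : closedFieldType) (p : {poly F}) (z : F) :
  p != 0 -> count_mem z (root_seq p) = mup z p.
Proof.
move=> p0; rewrite [in RHS](root_seq_prod p) -mul_polyC mupMr ?mu_prod_XsubC //.
by rewrite rootC lead_coef_eq0.
Qed.

Lemma size_root_seq (F : closedFieldType) (p : {poly F}) :
  p != 0 -> size (root_seq p) = (size p).-1.
Proof.
move=> p0; rewrite [in RHS](root_seq_prod p) size_scale ?lead_coef_eq0 //.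
by rewrite size_prod_XsubC.
Qed.

Lemma count_undup_sum (T : eqType) (s : seq T) (a : pred T) :
  (\sum_(w <- undup s | a w) count_mem w s)%N = count a s.
Proof.
rewrite -sum1_count -[RHS]big_undup_iterop_count; apply: eq_bigr => w _.
by rewrite Monoid.iteropE iter_addn_0 mul1n.
Qed.

Lemma eq_count_in (T : eqType) (a : pred T) (s t : seq T) :
  (forall w, a w -> count_mem w s = count_mem w t) -> count a s = count a t.
Proof.
move=> st; rewrite -!size_filter; apply/perm_size/allP => w _ /=.
rewrite !count_filter; apply/eqP; case aw : (a w).
  transitivity (count_mem w s).
    by apply: eq_count => x /=; case: eqP => // ->.
  by rewrite st //; apply: eq_count => x /=; case: eqP => // ->.
transitivity 0%N; last symmetry;
  apply/eqP; rewrite -[_ == _]negbK -lt0n -has_count;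
  by apply/negP => /hasP[x _ /= /andP[/eqP-> ]]; rewrite aw.
Qed.

(* The [z] in [zs] are the [N]-th roots of [rho ^+ N]; the sum comes from
   evaluating at [a] the logarithmic derivative of ['X^N - rho ^+ N]. *)
Lemma sum_circle (F : fieldType) (N : nat) (rho a : F) (zs : seq F) :
  'X^N - (rho ^+ N)%:P = \prod_(z <- zs) ('X - z%:P) -> a ^+ N != rho ^+ N ->
  \sum_(z <- zs) z / (z - a) = N%:R * (rho ^+ N / (rho ^+ N - a ^+ N)).
Proof.
move=> e aN.
have aN' : a ^+ N - rho ^+ N != 0 by rewrite subr_eq0.
have azs : a \notin zs.
  by rewrite -root_prod_XsubC -e rootE !hornerE.
have size_zs : size zs = N.
  case: N => [|N] in e aN aN' *; first by rewrite !expr0 eqxx in aN.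
  by apply/succn_inj; rewrite -(size_prod_XsubC _ id) -e size_XnsubC.
have := deriv_prod_XsubC azs; rewrite -e derivB derivC subr0 derivXn.
rewrite hornerMn hornerD hornerN hornerC !hornerXn => e'.
rewrite (eq_big_seq (fun z => 1 - a * (a - z)^-1)); last first.
  move=> z zs_z; have az : a - z != 0.
    by rewrite subr_eq0; apply: contraNneq azs => ->.
  have za : z - a != 0 by rewrite -opprB oppr_eq0.
  by field; rewrite ?za ?az.
rewrite sumrB -mulr_sumr -[X in a * X](mulKf aN') -e' big_const_seq count_predT.
rewrite size_zs iter_addr_0; case: N {e azs size_zs e'} aN aN' => [|N] aN aN'.
  by rewrite /= !mulr0n !mul0r !mulr0 subr0.
rewrite /= !mulrnAr -mulrCA -exprS.
rewrite !mulrA.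
have -> : rho ^+ N.+1 - a ^+ N.+1 = - (a ^+ N.+1 - rho ^+ N.+1) by ring.
rewrite -mulr_natr.
by move: (a ^+ N.+1) (rho ^+ N.+1) aN aN' => A B AB BA; field; rewrite oppr_eq0 BA.
Qed.

(** * Complex moduli as elements of the real field *)

Lemma normr_normc (R : rcfType) (x : R[i]) : `|x| = (normc x)%:C.
Proof. by []. Qed.

Lemma normc_ge0 (R : rcfType) (x : R[i]) : 0 <= normc x.
Proof. by rewrite -ler0c -normr_normc normr_ge0. Qed.

Lemma normc_real (R : rcfType) (x : R) : normc x%:C = `|x|.
Proof. by apply: complexI; rewrite -normr_normc normc_def /= expr0n addr0 sqrtr_sqr. Qed.

Lemma normcX (R : rcfType) (x : R[i]) n : normc (x ^+ n) = normc x ^+ n.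
Proof. by apply: complexI; rewrite rmorphXn -!normr_normc normrX. Qed.

Lemma normc_eq0 (R : rcfType) (x : R[i]) : (normc x == 0) = (x == 0).
Proof. by rewrite -(inj_eq (@complexI R)) -normr_normc normr_eq0. Qed.

Lemma normc_sum (R : rcfType) (I : Type) (s : seq I) (f : I -> R[i]) :
  normc (\sum_(i <- s) f i) <= \sum_(i <- s) normc (f i).
Proof.
rewrite -lecR -normr_normc rmorph_sum; exact: ler_norm_sum.
Qed.

Lemma lerB_normc (R : rcfType) (x y : R[i]) : normc x - normc y <= normc (x - y).
Proof. by have := le_normcD (x - y) y; rewrite subrK; lra. Qed.

(** * Discrete argument principle: limits of circle averages and equality of zero counts *)

Lemma geometric_small (R : archiRealFieldType) (y e : R) :
  0 <= y < 1 -> 0 < e -> exists N0, forall N, (N0 <= N)%N -> y ^+ N <= e.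
Proof.
move=> /andP[y0 y1] e0; have d0 : 0 < 1 - y by lra.
(* A Bernoulli-type bound: [y ^+ N] decays at least as fast as [1 / (1 + N * (1 - y))]. *)
have H N : y ^+ N * (1 + N%:R * (1 - y)) <= 1.
  elim: N => [|N IH]; first by rewrite expr0; lra.
  apply: le_trans IH; rewrite exprSr -mulrA ler_wpM2l ?exprn_ge0 //.
  rewrite -nat1r; have : 0 <= N%:R :> R by []; move: (N%:R : R) => x x0.
  have : 0 <= x * (1 - y) * (1 - y) by rewrite !mulr_ge0 // ltW.
  have : 0 <= (1 - y) * (1 - y) by rewrite !mulr_ge0 // ltW.
  lra.
exists (Num.bound ((1 - y) * e)^-1) => N NN0.
have p0 : 0 < (1 - y) * e by rewrite mulr_gt0.
have : ((1 - y) * e)^-1 < N%:R.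
  apply: lt_le_trans (archi_boundP _) _; last by rewrite ler_nat.
  by rewrite invr_ge0 ltW.
rewrite -(ltr_pM2r p0) mulVf ?gt_eqF // => NN.
have := H N; have := exprn_ge0 N y0; move: (y ^+ N) (N%:R : R) NN => Y x Hx Y0 HY.
nra.
Qed.

(** This form is the one [normc_div_le] consumes: it makes [x ^+ N / (y ^+ N - x ^+ N)] at most
    [e]. *)
Lemma power_gap (R : archiRealFieldType) (x y e : R) :
  0 <= x < y -> 0 < e ->
  exists N0, forall N, (N0 <= N)%N -> (1 + e) * x ^+ N <= e * y ^+ N.
Proof.
move=> /andP[x0 xy] e0; have y0 : 0 < y by lra.
have [||N0 HN] := @geometric_small R (x / y) (e / (1 + e)).
- by rewrite divr_ge0 //= ?ltr_pdivrMr ?mul1r // ltW.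
- by rewrite divr_gt0 // addr_gt0.
exists N0 => N /HN; rewrite expr_div_n ler_pdivrMr ?exprn_gt0 //.
have e1 : 0 < 1 + e by lra.
by rewrite mulrAC ler_pdivlMr // mulrC.
Qed.

Lemma normc_div_le (R : rcfType) (x y : R[i]) (e m : R) : 0 < e ->
  (1 + e) * normc x <= e * m -> m <= normc y + normc x -> normc (x / y) <= e.
Proof.
(* When [y = 0] the quotient is [0] by convention; otherwise the two hypotheses combine to
   [normc x <= e * normc y]. *)
move=> e0 xm my; have [->|y0] := eqVneq y 0.
  by rewrite invr0 mulr0 Normc.normc0 ltW.
have ny : 0 < normc y by rewrite lt_def normc_eq0 y0 normc_ge0.
rewrite Normc.normcM Normc.normcV ler_pdivrMr //.
have : e * m <= e * (normc y + normc x) by rewrite ler_pM2l.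
lra.
Qed.

(** On either side of the circle the error is, up to sign, the smaller power divided by the
    difference of the two powers: [a ^+ N] on top when [a] is inside, [rho ^+ N] when it is
    outside. *)
Lemma circle_term_limit (R : realType) (a : R[i]) (rho e : R) :
  0 < rho -> 0 < e -> normc a != rho ->
  exists N0, forall N, (N0 <= N)%N ->
  normc (rho%:C ^+ N / (rho%:C ^+ N - a ^+ N) - (normc a < rho)%R%:R) <= e.
Proof.
move=> rho0 e0 arho; have a0 := normc_ge0 a.
have nP N : normc (rho%:C ^+ N) = rho ^+ N by rewrite normcX normc_real gtr0_norm.
case: (ltrgtP (normc a) rho) arho => // arho _.
- have [|//|N0 HN] := @power_gap R (normc a) rho e; first by rewrite a0.
  exists N0 => N /HN {}HN.
  rewrite -normcX -nP in HN.
  have [D0|D0] := eqVneq (rho%:C ^+ N - a ^+ N) 0.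
    move/eqP : D0 HN; rewrite subr_eq0 => /eqP <-.
    have := exprn_gt0 N rho0; rewrite nP; lra.
  have -> : rho%:C ^+ N / (rho%:C ^+ N - a ^+ N) - 1
      = a ^+ N / (rho%:C ^+ N - a ^+ N).
    by field.
  apply: normc_div_le HN _ => //.
  by have := le_normcD (rho%:C ^+ N - a ^+ N) (a ^+ N); rewrite subrK.
- have [|//|N0 HN] := @power_gap R rho (normc a) e; first by rewrite ltW.
  exists N0 => N /HN {}HN.
  rewrite subr0; rewrite -normcX -nP in HN.
  apply: normc_div_le HN _ => //.
  have := le_normcD (a ^+ N - rho%:C ^+ N) (rho%:C ^+ N); rewrite subrK.
  by rewrite -[normc (_ - a ^+ N)]normcN opprB.
Qed.

Lemma circle_sum_limit (R : realType) (s : seq R[i]) (rho e : R) :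
  0 < rho -> 0 < e -> {in s, forall a, normc a != rho} ->
  exists N0, forall N, (N0 <= N)%N ->
  normc (\sum_(a <- s) rho%:C ^+ N / (rho%:C ^+ N - a ^+ N)
         - (count (fun a => (normc a < rho)%R) s)%:R) <= e.
Proof.
move=> rho0; elim: s e => [|a s IH] e e0 sP.
  by exists 0%N => N _; rewrite big_nil subr0 Normc.normc0 ltW.
have e2 : 0 < e / 2 by lra.
have [|N1 H1] := @circle_term_limit R a rho (e / 2) rho0 e2.
  by apply: sP; rewrite mem_head.
have [|N2 H2] := IH _ e2; first by move=> x xs; apply: sP; rewrite inE xs orbT.
exists (maxn N1 N2) => N; rewrite geq_max => /andP[/H1 {}H1 /H2 {}H2].
rewrite big_cons /= natrD opprD addrACA.
have := le_normcD
  (rho%:C ^+ N / (rho%:C ^+ N - a ^+ N) - (normc a < rho)%R%:R)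
  (\sum_(a <- s) rho%:C ^+ N / (rho%:C ^+ N - a ^+ N)
   - (count (fun a => (normc a < rho)%R) s)%:R).
lra.
Qed.

Lemma normc_natB_lt1 (R : rcfType) (m n : nat) :
  normc (m%:R - n%:R : R[i]) < 1 -> m = n.
Proof.
have -> : m%:R - n%:R = (m%:R - n%:R : R)%:C.
  by rewrite rmorphB !rmorph_nat.
rewrite normc_real ltr_norml => /andP[].
move=> nm mn; apply/eqP; rewrite eqn_leq -[(m <= n)%N]ltnS -[(n <= m)%N]ltnS.
rewrite -!(ltr_nat R) -!nat1r.
by apply/andP; split; lra.
Qed.

Lemma count_disk_eq (R : realType) (s t : seq R[i]) (rho : R) : 0 < rho ->
  {in s ++ t, forall a, normc a != rho} ->
  (forall z, normc z = rho ->
    normc (\sum_(a <- s) z / (z - a) - \sum_(a <- t) z / (z - a)) <= 2^-1) ->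
  count (fun a => normc a < rho) s = count (fun a => normc a < rho) t.
Proof.
move=> rho0 st_rho zst.
(* Two errors of 1/8 added to the hypothesis 1/2 stay below 1, which forces the two integer counts
   to agree. *)
have [||N1 H1] := @circle_sum_limit R s rho 8^-1 rho0; first by lra.
  by move=> a sa; apply: st_rho; rewrite mem_cat sa.
have [||N2 H2] := @circle_sum_limit R t rho 8^-1 rho0; first by lra.
  by move=> a ta; apply: st_rho; rewrite mem_cat ta orbT.
(* The successor keeps [N] positive, so that moduli can be recovered from their [N]-th powers and
   the factor [N] can be cancelled. *)
pose N := (maxn N1 N2).+1.
have {}H1 := H1 N (leqW (leq_maxl _ _)); have {}H2 := H2 N (leqW (leq_maxr _ _)).
have pn0 : 'X^N - (rho%:C ^+ N)%:P != 0 :> {poly R[i]}.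
  by rewrite -size_poly_eq0 size_XnsubC.
pose zs := root_seq ('X^N - (rho%:C ^+ N)%:P).
have zsE : 'X^N - (rho%:C ^+ N)%:P = \prod_(z <- zs) ('X - z%:P).
  by rewrite [LHS]root_seq_prod (monicP (monicXnsubC _ _)) ?scale1r.
have size_zs : size zs = N by rewrite size_root_seq // size_XnsubC.
have zs_rho z : z \in zs -> normc z = rho.
  rewrite mem_root_seq // rootE !hornerE subr_eq0 => /eqP /(congr1 (@Normc.normc R)).
  rewrite !normcX normc_real gtr0_norm // => /pexpIrn; apply => //.
    by rewrite nnegrE normc_ge0.
  by rewrite nnegrE ltW.
have avg (u : seq R[i]) : {in u, forall a, normc a != rho} ->
    \sum_(z <- zs) \sum_(a <- u) z / (z - a) =
    N%:R * \sum_(a <- u) rho%:C ^+ N / (rho%:C ^+ N - a ^+ N).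
  move=> urho; rewrite exchange_big mulr_sumr; apply: eq_big_seq => a ua.
  apply: sum_circle zsE _; apply: contra (urho a ua) =>
    /eqP /(congr1 (@Normc.normc R)).
  rewrite !normcX normc_real gtr0_norm // => /pexpIrn -> //.
    by rewrite nnegrE normc_ge0.
  by rewrite nnegrE ltW.
have : normc (\sum_(z <- zs)
    (\sum_(a <- s) z / (z - a) - \sum_(a <- t) z / (z - a)))
   <= N%:R * 2^-1.
  apply: le_trans (normc_sum _ _) _.
  rewrite -size_zs mulr_natl.
  rewrite [leRHS](_ : _ = \sum_(z <- zs) 2^-1); last first.
    by rewrite big_const_seq count_predT iter_addr_0.
  by rewrite big_seq [leRHS]big_seq ler_sum // => z /zs_rho /zst.
rewrite sumrB !avg; first last.
  by move=> a sa; apply: st_rho; rewrite mem_cat sa.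
  by move=> a ta; apply: st_rho; rewrite mem_cat ta orbT.
rewrite -mulrBr Normc.normcM.
have -> : normc (N%:R : R[i]) = N%:R.
  by rewrite -(rmorph_nat (real_complex R)) normc_real ger0_norm.
rewrite ler_pM2l ?ltr0n // => H3.
set S := \sum_(a <- s) _ in H1 H3; set T := \sum_(a <- t) _ in H2 H3.
apply: (@normc_natB_lt1 R).
set cs := _%:R in H1 *; set ct := _%:R in H2 *.
have -> : cs - ct = (S - T) + ((T - ct) - (S - cs)) by ring.
have := le_normcD (S - T) ((T - ct) - (S - cs)).
have := le_normcD (T - ct) (- (S - cs)).
rewrite (normcN (S - cs)); lra.
Qed.

(** Translation by [c] reduces to a circle around 0; the factor [rho] is the modulus of the
    numerator [z] in the terms [z / (z - a)]. *)
Lemma count_disk_eq_center (R : realType) (s t : seq R[i]) (c : R[i]) (rho : R) :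
  0 < rho -> {in s ++ t, forall a, normc (a - c) != rho} ->
  (forall z, normc (z - c) = rho ->
    rho * normc (\sum_(a <- s) (z - a)^-1 - \sum_(a <- t) (z - a)^-1) <= 2^-1) ->
  count (fun a => normc (a - c) < rho) s
  = count (fun a => normc (a - c) < rho) t.
Proof.
move=> rho0 st_rho zst.
have := @count_disk_eq R (map (fun a => a - c) s) (map (fun a => a - c) t) rho rho0.
rewrite !count_map; apply=> [a|z zrho].
  by rewrite -map_cat => /mapP[b /st_rho brho ->].
have := zst (z + c); rewrite addrK => /(_ zrho).
rewrite -{1}zrho -Normc.normcM mulrBr !mulr_sumr !big_map.
rewrite (eq_bigr (fun a => z / (z - (a - c)))); last first.
  by move=> a _; rewrite opprB addrA.
rewrite [X in normc (_ - X)](eq_bigr (fun a => z / (z - (a - c)))) //.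
by move=> a _; rewrite opprB addrA.
Qed.

(** * Gauss-Lucas for the unit disk *)

Lemma Re_inv_gt0 (R : rcfType) (x : R[i]) : 0 < complex.Re x -> 0 < complex.Re x^-1.
Proof.
case: x => a b /= a0. rewrite divr_gt0 //.
by rewrite ltr_pwDl ?sqr_ge0 // exprn_gt0.
Qed.

Lemma Re_le_normc (R : rcfType) (x : R[i]) : complex.Re x <= normc x.
Proof.
case: x => a b /=; apply: le_trans (ler_norm a) _.
by rewrite -sqrtr_sqr ler_wsqrtr // lerDl sqr_ge0.
Qed.

Lemma Re_sum_gt0 (R : rcfType) (I : eqType) (s : seq I) (f : I -> R[i]) :
  s != [::] -> {in s, forall i, 0 < complex.Re (f i)} ->
  0 < complex.Re (\sum_(i <- s) f i).
Proof.
have ReD (x y : R[i]) : complex.Re (x + y) = complex.Re x + complex.Re y.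
  by case: x; case: y.
elim: s => // a [|b s] IH _ sf; first by rewrite big_seq1 sf ?mem_head.
rewrite big_cons ReD addr_gt0 ?sf ?mem_head // IH // => x xs.
by rewrite sf // inE xs orbT.
Qed.

(* Each term of [c * p'(c) / p(c)] is [1 / (1 - w / c)] with [|w / c| < 1],
   hence has positive real part. *)
Lemma crit_normc_lt1 (R : rcfType) (p : {poly R[i]}) (c : R[i]) :
  (1 < size p)%N -> (forall z, root p z -> normc z < 1) ->
  root p^`() c -> normc c < 1.
Proof.
move=> sp p1 p'c; rewrite ltNge; apply/negP => c1.
have pc : ~~ root p c by apply/negP => /p1; rewrite ltNge c1.
have p0 : p != 0 by rewrite -size_poly_gt0 ltnW.
have c0 : c != 0.
  by rewrite -normc_eq0 gt_eqF // (lt_le_trans ltr01).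
have : 0 < complex.Re (\sum_(w <- root_seq p) (1 - w / c)^-1).
  apply: Re_sum_gt0.
    by rewrite -size_eq0 size_root_seq // -lt0n -ltnS prednK // ltnW.
  move=> w; rewrite mem_root_seq // => /p1 w1; apply: Re_inv_gt0.
  have -> : complex.Re (1 - w / c) = 1 - complex.Re (w / c) by case: (w / c).
  rewrite subr_gt0; apply: le_lt_trans (Re_le_normc _) _.
  rewrite Normc.normcM Normc.normcV ltr_pdivrMr; last by rewrite (lt_le_trans ltr01).
  by rewrite mul1r (lt_le_trans w1).
have -> : \sum_(w <- root_seq p) (1 - w / c)^-1
   = c * \sum_(w <- root_seq p) (c - w)^-1.
  rewrite mulr_sumr; apply: eq_bigr => w _.
  by rewrite -[RHS]invrK invfM invrK mulrBr mulVf // [c^-1 * w]mulrC.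
move: p'c; rewrite rootE deriv_root_seq // mulf_eq0 -rootE (negPf pc) /=.
by move/eqP->; rewrite mulr0 ltxx.
Qed.

(** * Degree of a derivative, and a radius avoiding finitely many values *)

Lemma size_deriv_char0 (R : numDomainType) (p : {poly R}) :
  size p^`() = (size p).-1.
Proof.
have [->|p0] := eqVneq p 0; first by rewrite deriv0 size_poly0.
case: (ltnP (size p) 2) => [sp|sp].
  by rewrite (size1_polyC (_ : (size p <= 1)%N)) // derivC size_poly0 size_polyC;
     case: eqP.
apply/eqP; rewrite eqn_leq -ltnS prednK ?(ltnW sp) // lt_size_deriv //=.
have sE : (size p).-2.+1 = (size p).-1 by case: (size p) sp => [|[]].
rewrite -sE ltnNge; apply/negP => /(nth_default 0)/eqP.
rewrite coef_deriv sE mulrn_eq0 -lead_coefE lead_coef_eq0 (negPf p0) orbF.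
by rewrite -sE.
Qed.

Lemma lead_coef_deriv_char0 (R : numDomainType) (p : {poly R}) :
  lead_coef p^`() = lead_coef p *+ (size p).-1.
Proof.
rewrite !lead_coefE size_deriv_char0 coef_deriv.
case: (ltnP 1 (size p)) => [sp|sp]; first by rewrite prednK // -ltnS prednK // ltnW.
have -> : (size p).-1 = 0%N by apply/eqP; rewrite -leqn0 -ltnS; case: (size p) sp.
by rewrite (nth_default 0 sp) mul0rn mulr0n.
Qed.

Lemma avoid_radius (R : archiRealFieldType) (s : seq R) (n : nat) (e : R) :
  (size s < n)%N -> 0 < e ->
  exists2 rho, 0 < rho < e & {in s, forall x, e / (2 * n%:R) <= `|x - rho|}.
Proof.
move=> sn e0; have n0 : 0 < n%:R :> R by rewrite ltr0n (leq_ltn_trans _ sn).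
(* [g x] is the index of the interval of length [e / n] containing [x]; a negative [x] is sent to 0,
   which is harmless since it can only mark one more index as occupied. *)
pose g (x : R) := Num.truncn (x * n%:R / e).
(* [n] disjoint intervals of length [e / n], fewer than [n] points. *)
have /hasP[k] : has (fun k => k \notin map g s) (iota 0 n).
  rewrite -[has _ _]negbK -all_predC; apply/negP => /allP gs.
  have := @uniq_leq_size _ (iota 0 n) (map g s) (iota_uniq 0 n).
  rewrite size_map size_iota leqNgt sn => H; suff : false by []; apply: H.
  by move=> k /gs /=; rewrite negbK.
rewrite mem_iota add0n => /andP[_ kn] ks.
have kn' : k%:R + 1 <= n%:R :> R by rewrite natr1 ler_nat.
have k0 : 0 <= k%:R :> R by [].
(* The midpoint of the free interval, at distance [e / (2 * n)] from both of its ends. *)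
exists (e * (2 * k%:R + 1) / (2 * n%:R)).
  apply/andP; split; first by rewrite !(mulr_gt0, invr_gt0) //; lra.
  by rewrite ltr_pdivrMr ?mulr_gt0 // ltr_pM2l //; lra.
move=> x sx; rewrite leNgt; apply/negP; rewrite ltr_norml => /andP[].
have d0 : 0 < 2 * n%:R :> R by rewrite mulr_gt0.
rewrite ltrBDr -mulNr -mulrDl ltr_pdivrMr // => lo.
rewrite ltrBlDr -mulrDl ltr_pdivlMr // => hi.
suff gx : g x = k by move: ks; rewrite -gx map_f.
apply: truncn_def; rewrite ler_pdivlMr // ltr_pdivrMr // -natr1.
by apply/andP; split; lra.
Qed.

(* The numerator of [(p * a / b)'] over the denominator [b ^+ 2]. *)
Definition crit_num (F : fieldType) (p a b : {poly F}) : {poly F} :=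
  (p * a)^`() * b - p * a * b^`().

(** * Size of the perturbation caused by the zeros and poles of [h] *)

(** Each term of the sum is at most [L], so [normc w >= 1 / L >= 2 * B >= 2 * normc z], and [z] is
    at distance at least [normc w / 2] from [w]. A root at 0 has to be excluded because its inverse
    would count as 0. *)
Lemma root_seq_far (R : rcfType) (s : seq R[i]) (B L : R) (z : R[i]) :
  0 < B -> 0 < L -> 2 * B * L <= 1 -> 0 \notin s ->
  \sum_(w <- s) (normc w)^-1 <= L -> normc z <= B ->
  {in s, forall w, normc (z - w)^-1 <= 2 * (normc w)^-1 /\ z != w}.
Proof.
move=> B0 L0 BL s0 sL zB w sw.
have w0 : 0 < normc w.
  by rewrite lt_def normc_ge0 andbT normc_eq0; apply: contraNneq s0 => <-.
have wL : (normc w)^-1 <= L.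
  apply: le_trans sL; rewrite (big_rem w) //= lerDl sumr_ge0 // => x _.
  by rewrite invr_ge0 normc_ge0.
have wB : 2 * B <= normc w.
  have := ler_wpM2l (ltW B0) wL.
  rewrite ler_pdivrMr // mulrC => H.
  nra.
have zw : normc w / 2 <= normc (z - w).
  by have := lerB_normc w z; rewrite -[normc (z - w)]normcN opprB; lra.
split; last by apply/eqP => zw0; move: zw; rewrite zw0 subrr Normc.normc0; lra.
rewrite Normc.normcV -[2]invrK -invfM lef_pV2 ?posrE; lra.
Qed.

Lemma root_seq_sums (R : rcfType) (s : seq R[i]) (B L : R) (z : R[i]) :
  0 < B -> 0 < L -> 2 * B * L <= 1 -> 0 \notin s ->
  \sum_(w <- s) (normc w)^-1 <= L -> normc z <= B ->
  normc (\sum_(w <- s) (z - w)^-1) <= 2 * L /\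
  normc (\sum_(w <- s) (z - w)^-1 ^+ 2) <= (2 * L) ^+ 2.
Proof.
move=> B0 L0 BL s0 sL zB.
have far := root_seq_far B0 L0 BL s0 sL zB.
have S1 : \sum_(w <- s) normc (z - w)^-1 <= 2 * L.
  apply: le_trans (_ : \sum_(w <- s) 2 * (normc w)^-1 <= _).
    by rewrite big_seq [leRHS]big_seq ler_sum // => w /far[].
  by rewrite -mulr_sumr ler_pM2l.
split; first exact: le_trans (normc_sum _ _) S1.
apply: le_trans (normc_sum _ _) _.
(* Each term is bounded by the whole sum, hence by [2 * L]; this is used for one factor of every
   square. *)
apply: le_trans (_ : \sum_(w <- s) (2 * L) * normc (z - w)^-1 <= _).
  rewrite big_seq [leRHS]big_seq ler_sum // => w sw.
  rewrite normcX expr2 ler_wpM2r ?normc_ge0 //.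
  apply: le_trans S1; rewrite (big_rem w) //= lerDl sumr_ge0 // => x _.
  exact: normc_ge0.
by rewrite -mulr_sumr expr2 ler_pM2l // mulr_gt0.
Qed.

(** Here [n1], [n2], [d1], [d2] stand for [a'/a], [a''/a], [b'/b], [b''/b], and [u], [s] for [p/p'],
    [p''/p']. The numerator factors as [a * b * p' * v]; in its derivative all terms containing [b']
    cancel. What remains after subtracting [s] is linear in the small quantities, over [v]. *)
Lemma crit_num_logder (F : fieldType) (p a b : {poly F}) (z n1 n2 d1 d2 u s : F) :
  p^`().[z] != 0 -> a.[z] != 0 -> b.[z] != 0 ->
  a^`().[z] = a.[z] * n1 -> a^`()^`().[z] = a.[z] * n2 ->
  b^`().[z] = b.[z] * d1 -> b^`()^`().[z] = b.[z] * d2 ->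
  p.[z] = p^`().[z] * u -> p^`()^`().[z] = p^`().[z] * s ->
  let v := 1 + u * (n1 - d1) in v != 0 ->
  (crit_num p a b).[z] != 0 /\
  (crit_num p a b)^`().[z] / (crit_num p a b).[z] - s =
  (2 * n1 + u * (n2 - d2) - s * u * (n1 - d1)) / v.
Proof.
move=> p'0 a0 b0 a1 a2 b1 b2 pu ps v v0.
have Q : (crit_num p a b).[z] = a.[z] * b.[z] * p^`().[z] * v.
  rewrite /crit_num !derivE !(hornerD, hornerN, hornerM) a1 b1 pu /v; ring.
have Q' : (crit_num p a b)^`().[z] = a.[z] * b.[z] * p^`().[z] *
    (s + 2 * n1 + u * (n2 - d2)).
  rewrite /crit_num !derivE !(hornerD, hornerN, hornerM) a1 b1 a2 b2 pu ps; ring.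
split; first by rewrite Q !mulf_neq0.
by rewrite Q Q' /v; field; apply/and4P.
Qed.

(** The hypothesis [4 * K * k <= 1] keeps [normc v] at least 1/2, and as [1 <= K] the numerator is
    at most [2 * k + 4 * K * k + 2 * K ^+ 2 * k <= 8 * K ^+ 2 * k]. *)
Lemma perturb_bound (R : rcfType) (K k : R) (n1 n2 d1 d2 u s : R[i]) :
  1 <= K -> 0 < k -> 4 * K * k <= 1 ->
  normc n1 <= k -> normc d1 <= k -> normc n2 <= 2 * k -> normc d2 <= 2 * k ->
  normc u <= K -> normc s <= K ->
  let v := 1 + u * (n1 - d1) in
  v != 0 /\
  normc ((2 * n1 + u * (n2 - d2) - s * u * (n1 - d1)) / v) <= 16 * K ^+ 2 * k.
Proof.
move=> K1 k0 Kk n1k d1k n2k d2k uK sK v.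
have nB (x y : R[i]) : normc (x - y) <= normc x + normc y.
  by rewrite -[normc y]normcN le_normcD.
have n2' : normc (2 : R[i]) = 2.
  by rewrite -(rmorph_nat (real_complex R)) normc_real ger0_norm.
have e1 : normc (u * (n1 - d1)) <= K * (2 * k).
  rewrite Normc.normcM ler_pM ?normc_ge0 //.
  by have := nB n1 d1; lra.
have e2 : normc (u * (n2 - d2)) <= K * (4 * k).
  rewrite Normc.normcM ler_pM ?normc_ge0 //.
  by have := nB n2 d2; lra.
have e3 : normc (s * u * (n1 - d1)) <= K * (K * (2 * k)).
  by rewrite -mulrA Normc.normcM ler_pM ?normc_ge0.
have vn : 2^-1 <= normc v.
  have := le_normcD v (- (u * (n1 - d1))).
  by rewrite /v addrK Normc.normc1 normcN -/v; lra.
have v0 : v != 0 by rewrite -normc_eq0 gt_eqF //; lra.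
split=> //; rewrite Normc.normcM Normc.normcV ler_pdivrMr; last by lra.
have := nB (2 * n1 + u * (n2 - d2)) (s * u * (n1 - d1)).
have := le_normcD (2 * n1) (u * (n2 - d2)).
rewrite Normc.normcM n2'.
have : 16 * K ^+ 2 * k * 2^-1 <= 16 * K ^+ 2 * k * normc v.
  by rewrite ler_wpM2l // !mulr_ge0 ?exprn_ge0 //; lra.
have : k <= K * k by rewrite ler_pMl.
have : K * k <= K * (K * k) by rewrite ler_pMl // mulr_gt0 //; lra.
rewrite expr2.
lra.
Qed.

(** * Bounds uniform in [p], and the resulting equality of zero counts *)

Lemma normc_prod_XsubC_le (R : rcfType) (s : seq R[i]) (z : R[i]) (M : R) :
  {in s, forall a, normc (z - a) <= M} ->
  normc (\prod_(a <- s) ('X - a%:P)).[z] <= M ^+ size s.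
Proof.
elim: s => [|a s IH] sM; first by rewrite big_nil hornerC Normc.normc1.
rewrite big_cons hornerM hornerXsubC Normc.normcM /= exprS.
rewrite ler_pM ?normc_ge0 ?sM ?mem_head // IH // => x xs.
by rewrite sM // inE xs orbT.
Qed.

Lemma normc_prod_XsubC_ge (R : rcfType) (s : seq R[i]) (z : R[i]) (M : R) :
  0 <= M -> {in s, forall a, M <= normc (z - a)} ->
  M ^+ size s <= normc (\prod_(a <- s) ('X - a%:P)).[z].
Proof.
move=> M0; elim: s => [|a s IH] sM; first by rewrite big_nil hornerC Normc.normc1.
rewrite big_cons hornerM hornerXsubC Normc.normcM /= exprS.
rewrite ler_pM ?exprn_ge0 ?sM ?mem_head // IH // => x xs.
by rewrite sM // inE xs orbT.
Qed.

(** The leading coefficient cancels in [p / p'], so [K] depends on [n], [B] and [d] only. The second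
    ratio is a sum of [n - 1] inverses of modulus at most [1 / d]; one crude [K] serves both. *)
Lemma deriv_ratio_bounds (R : rcfType) (n : nat) (B d : R) (p : {poly R[i]})
    (z : R[i]) :
  (0 < n)%N -> 0 < B -> 0 < d <= 1 -> size p = n.+1 ->
  (forall w, root p w -> normc w < 1) -> normc z <= B ->
  {in root_seq p^`(), forall a, d <= normc (z - a)} ->
  let K := n%:R * ((B + 1) / d) ^+ n in
  normc (p.[z] / p^`().[z]) <= K /\
  normc (p^`()^`().[z] / p^`().[z]) <= K.
Proof.
move=> n0 B0 /andP[d0 d1] sp p1 zB zd K.
have nge1 : 1 <= n%:R :> R by rewrite ler1n.
have p0 : p != 0 by rewrite -size_poly_eq0 sp.
have p'0 : p^`() != 0 by rewrite -size_poly_eq0 size_deriv_char0 sp -lt0n.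
have p'z : ~~ root p^`() z.
  rewrite -mem_root_seq //; apply/negP => /zd.
  by rewrite subrr Normc.normc0 leNgt d0.
have lp : lead_coef p != 0 by rewrite lead_coef_eq0.
have nlp : 0 < normc (lead_coef p) by rewrite lt_def normc_eq0 lp normc_ge0.
have q1 : 1 <= (B + 1) / d by rewrite ler_pdivlMr // mul1r; lra.
have p'E : d ^+ n.-1 * normc (lead_coef p) <= normc p^`().[z].
  rewrite [X in normc X.[_]]root_seq_prod hornerZ Normc.normcM mulrC.
  have := normc_prod_XsubC_ge (ltW d0) zd; rewrite size_root_seq //.
  rewrite size_deriv_char0 sp /= => H.
  rewrite ler_pM ?exprn_ge0 ?(ltW nlp) ?(ltW d0) //.
  rewrite lead_coef_deriv_char0 sp -mulr_natr Normc.normcM.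
  rewrite -(rmorph_nat (real_complex R)) normc_real ger0_norm //.
  by rewrite ler_pMr.
have pE : normc p.[z] <= (B + 1) ^+ n * normc (lead_coef p).
  rewrite [X in normc X.[_]]root_seq_prod hornerZ Normc.normcM mulrC.
  rewrite ler_pM2r // -[X in _ ^+ X]/(n.+1.-1) -sp -size_root_seq //.
  apply: normc_prod_XsubC_le => w; rewrite mem_root_seq // => /p1 w1.
  by have := le_normcD z (- w); rewrite normcN; lra.
have p'z0 : 0 < normc p^`().[z] by rewrite lt_def normc_ge0 andbT normc_eq0.
split.
  rewrite Normc.normcM Normc.normcV ler_pdivrMr //; apply: le_trans pE _.
  apply: le_trans (_ : K * (d ^+ n.-1 * normc (lead_coef p)) <= _); last first.
    by rewrite ler_wpM2l // /K mulr_ge0 // exprn_ge0 // (le_trans ler01 q1).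
  rewrite mulrA ler_pM2r // /K expr_div_n.
  have dn : 0 < d ^+ n.-1 by rewrite exprn_gt0.
  have -> : d ^+ n = d * d ^+ n.-1 by rewrite -exprS prednK.
  rewrite -mulrA -mulrA [(d * _)^-1 * _]mulrC invfM [_ * (d^-1 * _)]mulrCA.
  rewrite divff ?gt_eqF // mulr1.
  have Bn : 0 <= (B + 1) ^+ n by rewrite exprn_ge0; lra.
  have d'1 : 1 <= d^-1 by rewrite invf_ge1.
  apply: le_trans (_ : 1 * ((B + 1) ^+ n * d^-1) <= _).
    by rewrite mul1r ler_peMr.
  by rewrite ler_wpM2r // mulr_ge0 // invr_ge0 ltW.
rewrite deriv_root_seq // mulrAC divff // mul1r.
apply: le_trans (normc_sum _ _) _.
apply: le_trans (_ : \sum_(w <- root_seq p^`()) ((B + 1) / d) ^+ n <= _).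
  rewrite big_seq [leRHS]big_seq ler_sum // => w /zd wd.
  apply: le_trans (ler_eXnr n0 q1).
  rewrite Normc.normcV.
  apply: le_trans (_ : d^-1 <= _); first by rewrite lef_pV2 ?posrE //; lra.
  by rewrite ler_peMl ?invr_ge0 ?ltW //; lra.
rewrite big_const_seq count_predT iter_addr_0 size_root_seq // size_deriv_char0 sp /=.
rewrite -mulr_natl ler_wpM2r ?exprn_ge0 ?(le_trans ler01 q1) //.
by rewrite ler_nat leq_pred.
Qed.

Lemma count_crit_num (R : realType) (n : nat) (B d : R) :
  (0 < n)%N -> 1 <= B -> 0 < d <= 1 ->
  exists2 L : R, 0 < L &
    forall p a b : {poly R[i]}, size p = n.+1 ->
      (forall w, root p w -> normc w < 1) -> a != 0 -> b != 0 ->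
      0 \notin root_seq a ++ root_seq b ->
      \sum_(w <- root_seq a ++ root_seq b) (normc w)^-1 < L ->
      (forall z, normc z <= B -> ~~ root a z /\ ~~ root b z) /\
      (forall c rho, 0 < rho <= B ->
        (forall z, normc (z - c) = rho -> normc z <= B /\
           {in root_seq p^`(), forall x, d <= normc (z - x)}) ->
        crit_num p a b != 0 /\
        count (fun x => normc (x - c) < rho) (root_seq (crit_num p a b)) =
        count (fun x => normc (x - c) < rho) (root_seq p^`())).
Proof.
move=> n0 B1 d01; have /andP[d0 d1] := d01.
have B0 : 0 < B by lra.
have [K KE] : exists K, K = n%:R * ((B + 1) / d) ^+ n.
  by exists (n%:R * ((B + 1) / d) ^+ n).
have K1 : 1 <= K.
  have nge1 : 1 <= n%:R :> R by rewrite ler1n.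
  have q1 : 1 <= (B + 1) / d by rewrite ler_pdivlMr // mul1r; lra.
  by rewrite KE mulr_ege1 // exprn_ege1.
have K2 : K <= K ^+ 2 by rewrite expr2 ler_peMr //; lra.
have BK0 : 0 < 64 * B * K ^+ 2 by rewrite !mulr_gt0 // ?exprn_gt0 //; lra.
(* With [k = 2 * L], [perturb_bound] gives [16 * K ^+ 2 * (2 * L)]; multiplied by a radius at most
   [B] this is exactly the 1/2 allowed by [count_disk_eq_center]. *)
exists (64 * B * K ^+ 2)^-1; first by rewrite invr_gt0.
set L := _^-1 => p a b sp p1 a0 b0 ab0 abL.
have L0 : 0 < L by rewrite invr_gt0.
have LE : 64 * (B * (K ^+ 2 * L)) = 1.
  by transitivity (64 * B * K ^+ 2 * L); [ring | exact: mulfV (lt0r_neq0 BK0)].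
clearbody L.
have BKL : K ^+ 2 * L <= B * (K ^+ 2 * L).
  by rewrite ler_peMl // mulr_ge0 ?exprn_ge0 //; lra.
have KL : K * L <= K ^+ 2 * L by rewrite ler_wpM2r // ltW.
have L1 : L <= K * L by rewrite ler_peMl // ltW.
have BL : 2 * B * L <= 1.
  have : B * L <= B * (K ^+ 2 * L) by rewrite ler_pM2l //; lra.
  lra.
have inv0 (s : seq R[i]) : 0 <= \sum_(w <- s) (normc w)^-1.
  by rewrite sumr_ge0 // => w _; rewrite invr_ge0 normc_ge0.
move: ab0 abL; rewrite mem_cat negb_or big_cat /= => /andP[sa0 sb0] abL.
have aL : \sum_(w <- root_seq a) (normc w)^-1 <= L.
  by have := inv0 (root_seq b); lra.
have bL : \sum_(w <- root_seq b) (normc w)^-1 <= L.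
  by have := inv0 (root_seq a); lra.
have nroot z : normc z <= B -> ~~ root a z /\ ~~ root b z.
  move=> zB; rewrite -!mem_root_seq //; split; apply/negP => zs.
    by have [_] := root_seq_far B0 L0 BL sa0 aL zB zs; rewrite eqxx.
  by have [_] := root_seq_far B0 L0 BL sb0 bL zB zs; rewrite eqxx.
split=> // c rho /andP[rho0 rhoB] circ.
have est z : normc (z - c) = rho -> (crit_num p a b).[z] != 0 /\
    rho * normc ((crit_num p a b)^`().[z] / (crit_num p a b).[z] -
      p^`()^`().[z] / p^`().[z]) <= 2^-1.
  move=> /circ[zB zd].
  have [az bz] := nroot z zB.
  have [A1 A2] := root_seq_sums B0 L0 BL sa0 aL zB.
  have [D1 D2] := root_seq_sums B0 L0 BL sb0 bL zB.
  have p'z : p^`().[z] != 0.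
    rewrite -rootE -mem_root_seq; last first.
      by rewrite -size_poly_eq0 size_deriv_char0 sp -lt0n.
    by apply/negP => /zd; rewrite subrr Normc.normc0 leNgt d0.
  have [uK sK] := deriv_ratio_bounds n0 B0 d01 sp p1 zB zd.
  rewrite -KE in uK sK.
  (* Bounds [a''/a] and [b''/b], each a squared sum minus a sum of squares; [2 * L <= 1] turns the
     quadratic bound into a linear one. *)
  have sq (x y : R[i]) : normc x <= 2 * L -> normc y <= (2 * L) ^+ 2 ->
      normc (x ^+ 2 - y) <= 2 * (2 * L).
    move=> xL yL; have := le_normcD (x ^+ 2) (- y); rewrite normcN normcX.
    have : normc x ^+ 2 <= (2 * L) ^+ 2 by rewrite lerXn2r ?nnegrE ?normc_ge0 //; lra.
    have : (2 * L) ^+ 2 <= 2 * L by rewrite expr2 ler_piMl //; lra.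
    lra.
  have [||v0 bnd] := perturb_bound K1 _ _ A1 D1 (sq _ _ A1 A2) (sq _ _ D1 D2) uK sK.
  - by lra.
  - by rewrite -mulrA; lra.
  have pu : p.[z] = p^`().[z] * (p.[z] / p^`().[z]) by rewrite mulrC divfK.
  have ps : p^`()^`().[z] = p^`().[z] * (p^`()^`().[z] / p^`().[z]).
    by rewrite mulrC divfK.
  have [Q0 ->] := crit_num_logder p'z az bz (deriv_root_seq az)
    (deriv2_root_seq az) (deriv_root_seq bz) (deriv2_root_seq bz) pu ps v0.
  split=> //; apply: le_trans (_ : B * (16 * K ^+ 2 * (2 * L)) <= _).
    by apply: ler_pM => //; [exact: ltW | exact: normc_ge0].
  have -> : B * (16 * K ^+ 2 * (2 * L)) = 32 * (B * (K ^+ 2 * L)) by ring.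
  lra.
have Q0 : crit_num p a b != 0.
  have [|+ _] := est (c + rho%:C).
    by rewrite addrAC subrr add0r normc_real gtr0_norm.
  by apply: contraNneq => ->; rewrite horner0.
have p'0 : p^`() != 0 by rewrite -size_poly_eq0 size_deriv_char0 sp -lt0n.
split=> //; apply: count_disk_eq_center => // [x|z zrho].
  rewrite mem_cat !mem_root_seq // => xr; apply/eqP => xrho.
  case/orP: xr => [|xr]; first by rewrite rootE (negPf (est _ xrho).1).
  have [_ /(_ x)] := circ _ xrho.
  by rewrite mem_root_seq // xr subrr Normc.normc0 leNgt d0 => /(_ isT).
have [Qz bnd] := est _ zrho.
have p'z : ~~ root p^`() z.
  rewrite -mem_root_seq //; apply/negP => zs.
  by have [_ /(_ z zs)] := circ _ zrho; rewrite subrr Normc.normc0 leNgt d0.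
have quot (q : {poly R[i]}) : ~~ root q z ->
   \sum_(w <- root_seq q) (z - w)^-1 = q^`().[z] / q.[z].
  by move=> qz; rewrite deriv_root_seq // mulrC mulKf.
by rewrite !quot.
Qed.

(** * From fractions in lowest terms to polynomial numerators *)

(** Cross-multiplying, a root [w] of the reduced denominator would also be a root of the reduced
    numerator, against coprimality; so both denominators are non-zero at [w] and do not affect the
    multiplicity. *)
Lemma mup_rnum_frac (F : fieldType) (q b : {poly F}) (w : F) :
  b != 0 -> ~~ root b w -> mup w (rnum (q%:F / b%:F)) = mup w q.
Proof.
move=> b0 bw; set h := _ / _.
have e : rnum h * b = q * rden h.
  apply/eqP; rewrite -tofrac_eq !tofracM -eqr_div ?tofrac_eq0 ?rden_neq0 //.
  by rewrite -ratE.
have dw : ~~ root (rden h) w.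
  apply/negP => dw; have : root (rnum h * b) w by rewrite e rootM dw orbT.
  rewrite rootM (negPf bw) orbF => nw.
  by have := coprimep_root (coprime_rat h) nw; rewrite (eqP dw) eqxx.
by rewrite -(mupMl (rnum h) bw) e mupMl.
Qed.

(** Zeros of [q] lost in the reduction lie at roots of [b], hence outside [D], so an unreduced
    numerator may be used for counting. *)
Lemma num_crit_frac (F : closedFieldType) (f : {fraction {poly F}})
    (q b : {poly F}) (D : pred F) :
  rderiv f = q%:F / b%:F -> q != 0 -> b != 0 ->
  (forall w, D w -> ~~ root b w) -> num_crit f D = count D (root_seq q).
Proof.
move=> fE q0 b0 Db; have n0 : rnum (rderiv f) != 0.
  apply: contraNneq q0 => n0; have := ratE (rderiv f).
  rewrite n0 tofrac0 mul0r fE => /eqP.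
  by rewrite mulf_eq0 invr_eq0 !tofrac_eq0 (negPf b0) orbF.
rewrite /num_crit /crit_points /zeros /crit_mult.
transitivity (count D (root_seq (rnum (rderiv f)))).
  rewrite -count_undup_sum; apply: eq_bigr => w _.
  by rewrite -count_mem_root_seq.
apply: eq_count_in => w /Db bw.
by rewrite !count_mem_root_seq // fE mup_rnum_frac.
Qed.

(** By coprimality each [w] is a root of only one of numerator and denominator, so the absolute
    value of [mult h w] is the number of occurrences of [w] in the concatenation. *)
Lemma rho_root_seq (R : rcfType) (h : {fraction {poly R[i]}}) :
  ~~ root (rnum h) 0 -> ~~ root (rden h) 0 ->
  rho h 0 =
  (\sum_(w <- root_seq (rnum h) ++ root_seq (rden h)) (normc w)^-1)%:C.
Proof.
move=> nh0 dh0; have n0 : rnum h != 0 by apply: contraNneq nh0 => ->; rewrite root0.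
have d0 := rden_neq0 h.
rewrite /rho rmorph_sum -[RHS]big_undup_iterop_count /=.
set s := root_seq _ ++ root_seq _.
have ps : perm_eq (undup (zeros h ++ poles h)) (undup s).
  by apply: uniq_perm; rewrite ?undup_uniq // => w; rewrite !(mem_undup, mem_cat).
rewrite (perm_big _ ps) big_seq_cond [RHS]big_seq; apply: eq_big => w.
  apply/andb_idr; rewrite mem_undup mem_cat !mem_root_seq //; apply: contraTneq => ->.
  by rewrite negb_or nh0.
rewrite mem_undup mem_cat !mem_root_seq // => /andP[wroot _].
rewrite Monoid.iteropE iter_addr_0 sub0r normrM normfV normrN normr_normc.
rewrite fmorphV /= -[RHS]mulr_natl; congr (_ * _).
rewrite count_cat !count_mem_root_seq // /mult.
case/orP: wroot => [nw|dw].
  have dw : ~~ root (rden h) w by rewrite rootE (coprimep_root (coprime_rat h) nw).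
  by rewrite (mupNroot dw) subr0 addn0 -pmulrn -normr_normc normr_nat.
have nw : ~~ root (rnum h) w.
  by apply: contraL dw => nw; rewrite rootE (coprimep_root (coprime_rat h) nw).
by rewrite (mupNroot nw) add0n sub0r mulrNz normcN -pmulrn -normr_normc normr_nat.
Qed.

Lemma rderivM_frac (F : fieldType) (p : {poly F}) (h : {fraction {poly F}}) :
  rderiv (p%:F * h) = (crit_num p (rnum h) (rden h))%:F / (rden h ^+ 2)%:F.
Proof.
by rewrite -rderiv_frac ?rden_neq0 // tofracM -mulrA -ratE.
Qed.

Lemma rderiv_tofrac (F : fieldType) (p : {poly F}) :
  rderiv p%:F = (p^`())%:F / 1%:F.
Proof.
rewrite -[p%:F]divr1 -tofrac1 rderiv_frac ?oner_eq0 // expr1n.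
by rewrite derivE mulr0 subr0 mulr1.
Qed.

(** * Application to the circle of radius [r] and to small circles around critical points *)

Theorem theorem4 (R : realType) (n : nat) (r eps : R)
    (hn : (0 < n)%N) (hr : 1 < r) (heps : 0 < eps) :
  exists2 L : R, 0 < L &
    forall (p : {poly R[i]}) (h : {fraction {poly R[i]}}),
      size p = n.+1 -> (forall z : R[i], root p z -> `|z| < 1) ->
      h != 0 -> rho h 0 < L%:C ->
      finite_at h 0 -> reval h 0 != 0 ->
      [/\ nonconstant (p%:F * h),
          (forall (z : R[i]) (m : nat),
             z \in crit_points p%:F -> crit_mult p%:F z = m ->
             (m <= num_crit (p%:F * h)%R (fun w => (`|w - z| < eps%:C)%R))%N)
        & num_crit (p%:F * h) (fun w => `|w| < r%:C) = n.-1].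
Proof.
have n0 : 0 < 2 * n%:R :> R by rewrite mulr_gt0 // ltr0n.
(* Large enough for the disk of radius [r] and for every [eps]-disk around a point of the unit
   disk. *)
pose B := r + 1 + eps.
(* [r - 1] separates the circle of radius [r] from the unit disk, [eps / (2 * n)] comes from
   [avoid_radius], and 1 is the cap required by [count_crit_num]. *)
pose d := Num.min 1 (Num.min (r - 1) (eps / (2 * n%:R))).
have B1 : 1 <= B by rewrite /B; lra.
have d01 : 0 < d <= 1.
  by rewrite /d !lt_min ge_min lexx divr_gt0 // !andbT; lra.
have dr : d <= r - 1 by rewrite /d !ge_min lexx orbT.
have de : d <= eps / (2 * n%:R) by rewrite /d !ge_min lexx !orbT.
have [L L0 count_L] := count_crit_num hn B1 d01.
exists L => // p h sp p1 _ rhoL h0 hn0.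
have {}p1 z : root p z -> normc z < 1 by move/p1; rewrite normr_normc ltcR.
have dh0 : ~~ root (rden h) 0.
  by move: h0; rewrite /finite_at mem_undup mem_root_seq ?rden_neq0.
have nh0 : ~~ root (rnum h) 0.
  by move: hn0; rewrite /reval mulf_eq0 negb_or => /andP[].
have n_neq0 : rnum h != 0 by apply: contraNneq nh0 => ->; rewrite root0.
have d_neq0 := rden_neq0 h.
rewrite rho_root_seq // ltcR in rhoL.
have [|nroot count_eq] := count_L p (rnum h) (rden h) sp p1 n_neq0 d_neq0 _ rhoL.
  by rewrite mem_cat !mem_root_seq // negb_or nh0.
have p'0 : p^`() != 0 by rewrite -size_poly_eq0 size_deriv_char0 sp -lt0n.
have p'1 x : x \in root_seq p^`() -> normc x < 1.
  by rewrite mem_root_seq // => /(crit_normc_lt1 _ p1) -> //; rewrite sp.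
have nrootX w : normc w <= B -> ~~ root (rden h ^+ 2) w.
  by case/nroot => _; rewrite expr2 rootM orbb.
have d2_neq0 : rden h ^+ 2 != 0 by rewrite expf_neq0.
have [Q0 count_r] : crit_num p (rnum h) (rden h) != 0 /\
  count (fun x => normc (x - 0) < r) (root_seq (crit_num p (rnum h) (rden h)))
  = count (fun x => normc (x - 0) < r) (root_seq p^`()).
  apply: count_eq; first by rewrite /B; apply/andP; split; lra.
  move=> z; rewrite subr0 => zr; split; first by rewrite zr /B; lra.
  move=> x /p'1 x1; have := lerB_normc z x; lra.
have numE (D : pred R[i]) : (forall w, D w -> normc w <= B) ->
    num_crit (p%:F * h) D = count D (root_seq (crit_num p (rnum h) (rden h))).
  by move=> DB; apply: num_crit_frac (rderivM_frac p h) _ _ _ => // w /DB /nrootX.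
split.
(* A constant product would have zero derivative, whereas its numerator [crit_num] is non-zero by
   [Q0]. *)
- move=> c ph; have := rderivM_frac p h; rewrite ph rderiv_tofrac derivC.
  rewrite tofrac0 mul0r => /esym/eqP.
  by rewrite mulf_eq0 invr_eq0 !tofrac_eq0 (negPf Q0) (negPf d2_neq0).
- move=> z [//|m] _ zm.
  have {}zm : mup z p^`() = m.+1.
    by rewrite -zm /crit_mult rderiv_tofrac mup_rnum_frac ?oner_eq0 // root1.
  have zp' : z \in root_seq p^`().
    rewrite mem_root_seq //; apply: contra_eqT zm => /mupNroot ->.
    by [].
  have z1 := p'1 _ zp'.
  have [|rho /andP[rho0 rhoe] rhoP] := @avoid_radius R
    (map (fun a => normc (a - z)) (root_seq p^`())) n eps _ heps.
    by rewrite size_map size_root_seq // size_deriv_char0 sp /= prednK.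
  have [|x xz|_ count_z] := count_eq z rho; first by rewrite rho0 /B; lra.
    split; first by have := le_normcD (x - z) z; rewrite subrK /B; lra.
    move=> a ap'; apply: le_trans de _.
    apply: le_trans (rhoP (normc (a - z)) _) _.
      exact: (map_f (fun a => normc (a - z))).
    (* Reverse triangle inequality, using [normc (x - z) = rho]. *)
    rewrite ler_norml; apply/andP; split.
      by have := le_normcD (x - a) (a - z); rewrite addrA subrK; lra.
    have := le_normcD (a - x) (x - z).
    by rewrite addrA subrK -[normc (a - x)]normcN opprB; lra.
  rewrite numE => [|w]; last first.
    by rewrite normr_normc ltcR => wz;
    have := le_normcD (w - z) z; rewrite subrK /B; lra.
  (* The [m] copies of [z] lie in the [rho]-disk, where both counts agree, and that disk lies in the
     [eps]-disk. *)
  rewrite -zm -count_mem_root_seq //.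
  apply: leq_trans
    (_ : (count (fun x => normc (x - z) < rho)%R (root_seq p^`()) <= _)%N).
    by apply: sub_count => x /= /eqP ->; rewrite subrr Normc.normc0.
  rewrite -count_z; apply: sub_count => x /= xz.
  by rewrite normr_normc ltcR (lt_trans xz).
- rewrite numE => [|w]; last by rewrite normr_normc ltcR /B; lra.
  rewrite (eq_count (a2 := fun x => normc (x - 0) < r)) => [|x]; last first.
    by rewrite /= subr0 normr_normc ltcR.
  rewrite count_r -[RHS]/(n.+1.-1.-1) -sp -size_deriv_char0 -size_root_seq //.
  apply/eqP; rewrite -all_count; apply/allP => x /p'1 x1 /=.
  by rewrite subr0; lra.
Qed.
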